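(* Let $p>3$ be a prime number. Then there are exactly $2$ isomorphism classes of quaternion left braces of size $4p$, i.e. of left braces of size $4p$ whose multiplicative group is isomorphic to the generalized quaternion (dicyclic) group $\mathbb{Z}_p\rtimes_{-1}\mathbb{Z}_4=\langle \sigma,\tau \mid \sigma^4=\tau^p=1,\ \sigma\tau\sigma^{-1}=\tau^{-1}\rangle$.
   Context: A skew (left) brace is a triple $(B,+,\circ)$ where $(B,+)$ and $(B,\circ)$ are groups such that $a\circ(b+c)=a\circ b-a+a\circ c$ for all $a,b,c\in B$. A left brace is a skew brace with $(B,+)$ abelian. The multiplicative group of the brace is $(B,\circ)$. An isomorphism of (skew) braces is a bijection that is a homomorphism for both operations. *)

(* Defs.v *)
From HB Require Import structures.
From mathcomp Require Import all_boot ssralg all_fingroup.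

Set Implicit Arguments.
Unset Strict Implicit.
Unset Printing Implicit Defensive.

Local Open Scope ring_scope.

(* (B, +) is the zmodType structure (hence abelian) and (B, o) the groupType  *)
(* structure, so that a o b is written (a * b)%g. Nothing relates 0 and 1%g   *)
(* a priori: their equality is a consequence of the axiom.                    *)
HB.mixin Record ZmodGroup_isLeftBrace B of GRing.Zmodule B & monoid.Group B := {
  braceDr : forall a b c : B, (a * (b + c)%R)%g = (a * b)%g - a + (a * c)%g
}.

#[short(type="leftBraceType")]
HB.structure Definition LeftBrace :=
  {B of ZmodGroup_isLeftBrace B & GRing.Zmodule B & monoid.Group B}.

#[short(type="finLeftBraceType")]
HB.structure Definition FinLeftBrace := {B of LeftBrace B & Finite B}.

Definition brace_isomorphic (A B : leftBraceType) : Prop :=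
  exists f : A -> B,
    [/\ bijective f,
        {morph f : x y / x + y}
      & {morph f : x y / (x * y)%g}].

(* "\isog Grp" compares finite quotients only; this is isomorphism with the   *)
(* presented group here, because the latter is finite (of order 4p) for p > 0.*)
Definition quaternion_brace (p : nat) (B : finLeftBraceType) : Prop :=
  ([set: B] \isog Grp (s : t : s ^+ 4 = t ^+ p = 1, s * t * s^-1 = t^-1))%g.

(* r is a system of representatives, indexed without repetition, of the      *)
(* isomorphism classes of the finite left braces satisfying P.                *)
Definition num_iso_classes (P : finLeftBraceType -> Prop) (n : nat) : Prop :=
  exists r : 'I_n -> finLeftBraceType,
    [/\ forall i, P (r i),
        forall i j, brace_isomorphic (r i) (r j) -> i = j
      & forall B, P B -> exists i, brace_isomorphic B (r i)].

(* Main.v *)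
(* Write lam a b = a o b - a. The additive 4- and p-torsion of B are stable     *)
(* under lam, hence are subgroups of (B, o), namely a Sylow 2-subgroup <s> and  *)
(* the normal subgroup <t> of order p. As p > 3, lam t has no nontrivial orbit  *)
(* on either, so lam t = id; then s o t = t^-1 o s gives lam s t = - t, and     *)
(* lam is determined by lam s on {0, s, s^2, s^3}. This restriction is either   *)
(* the identity, and (B, +) is Z/4 x Z/p, or a nontrivial unipotent map, and    *)
(* (B, +) is (Z/2)^2 x Z/p. In both cases a o b = a + f^(e a) b for an additive *)
(* involution f and a homomorphism e from (B, +) to Z/2 invariant under f.      *)

Require Import Defs.
From HB Require Import structures.
From mathcomp Require Import all_boot all_algebra all_fingroup all_solvable.

Set Implicit Arguments.
Unset Strict Implicit.
Unset Printing Implicit Defensive.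

Import GRing.Theory.

(** Writing a o b = a + [lam a b] makes [lam] an action of (B, o) on (B, +) by automorphisms, and o
    is recovered from + and [lam]; so the classification is that of the possible [lam].

    At most two classes: the two generators of the presentation can be conjugated so that they span
    the additive 4- and p-torsion ([quaternion_brace_generators]). Then [lam t] is trivial ([lam_t])
    and [lam s] negates [t] ([lam_s_t]), which leaves only the action of [s] on the 4-torsion;
    [lam_sylow2_cases] finds two possibilities, and [twist_brace_isomorphic] matches each with an
    explicit model.

    At least two: both models are quaternion by [twist_quaternion], which rests on recognizing the
    presented group by its order ([isoGrp_dicyclic_full]). They differ already additively:
    multiplication by 2p kills (Z/2)^2 x Z/p but not Z/4 x Z/p ([cyclic_not_elementary]). *)

Lemma coprime4_prime (q : nat) : prime q -> 3 < q -> coprime 4 q.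
Proof.
move=> q_pr q_gt3; rewrite (@coprime_pexpl 2 2) // prime_coprime // dvdn_prime2 //.
by apply: contraTneq q_gt3 => <-.
Qed.

(** * Recognizing the dicyclic group from its presentation *)

Section DicyclicPresentation.

Local Open Scope group_scope.

Variable p : nat.

Definition dicyclic_relations (gT : finGroupType) (s t : gT) : Prop :=
  [/\ s ^+ 4 = 1, t ^+ p = 1 & s * t * s^-1 = t^-1].

Lemma homg_dicyclicP (gT : finGroupType) (G : {group gT}) :
  reflect (exists s t, <[s]> <*> <[t]> = G /\ dicyclic_relations s t)
    (G \homg Grp (s : t : s ^+ 4 = t ^+ p = 1, s * t * s^-1 = t^-1)).
Proof.
apply: (iffP existsP) => [[[s t]] | [s [t [defG [s4 tp st]]]]].
  rewrite /= !xpair_eqE => /and4P[/eqP defG /eqP s4 /eqP tp /eqP st].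
  by exists s, t.
by exists (s, t); rewrite /= !xpair_eqE s4 tp st defG !eqxx.
Qed.

Lemma dicyclic_norm (gT : finGroupType) (s t : gT) :
  dicyclic_relations s t -> <[s]> \subset 'N(<[t]>).
Proof.
case=> _ _ st; rewrite cycle_subG.
(* Conjugation in the library is [x ^ y = y^-1 * x * y], so the relation speaks of [t ^ s^-1]. *)
have ->: s = s^-1^-1 by rewrite invgK.
by rewrite groupV inE -cycleJ conjgE invgK mulgA st cycleV.
Qed.

Lemma dicyclic_gen_mul (gT : finGroupType) (s t : gT) :
  dicyclic_relations s t -> <[t]> <*> <[s]> = <[t]> * <[s]>.
Proof. by move/dicyclic_norm => nts; rewrite norm_joinEr. Qed.

Hypothesis p_prime : prime p.

Lemma card_dicyclic_gen_leq (gT : finGroupType) (s t : gT) :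
  dicyclic_relations s t -> #|<[s]> <*> <[t]>| <= 4 * p.
Proof.
move=> dic; rewrite joingC dicyclic_gen_mul //.
have [s4 tp _] := dic.
apply: leq_trans (_ : #|<[t]>| * #|<[s]>| <= _).
  by rewrite mul_cardG leq_pmulr // cardG_gt0.
rewrite mulnC leq_mul //; apply: dvdn_leq => //.
- by rewrite -orderE order_dvdn s4.
- exact: prime_gt0.
- by rewrite -orderE order_dvdn tp.
Qed.

(* For s', t' in another group satisfying the relations, the subgroup of the  *)
(* product generated by (s, s') and (t, t') has order at most 4p; hence its   *)
(* projection onto G is injective, and its projection onto <s', t'> makes the *)
(* latter a quotient of G.                                                    *)
Lemma isoGrp_dicyclic (gT : finGroupType) (G : {group gT}) :
    #|G| = (4 * p)%N ->
    (exists s t, <[s]> <*> <[t]> = G /\ dicyclic_relations s t) ->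
  G \isog Grp (s : t : s ^+ 4 = t ^+ p = 1, s * t * s^-1 = t^-1).
Proof.
move=> oG genG; apply: intro_isoGrp; first exact/homg_dicyclicP.
move=> rT H /homg_dicyclicP[s' [t' [defH [s4' tp' st']]]].
case: genG => s [t [defG [s4 tp st]]].
pose x := (s, s'); pose y := (t, t'); pose K := (<[x]> <*> <[y]>)%G.
have expP n (a : gT) (b : rT) : (a, b) ^+ n = (a ^+ n, b ^+ n).
  by elim: n => // n IHn; rewrite !expgS IHn.
have dicK : dicyclic_relations x y.
  split; rewrite ?expP ?s4 ?s4' ?tp ?tp' //.
  by rewrite -[RHS]/(_, _) -st -st'.
have fstK : fst_morphism gT rT @* K = G.
  by rewrite -defG morphimY ?subsetT // !morphim_cycle ?inE.
have sndK : snd_morphism gT rT @* K = H.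
  by rewrite -defH morphimY ?subsetT // !morphim_cycle ?inE.
have oK : #|K| = #|G|.
  apply/eqP; rewrite eqn_leq oG card_dicyclic_gen_leq //= -oG -fstK.
  exact: leq_morphim.
have isoGK : G \isog K.
  by rewrite isogEcard oK leqnn andbT -fstK morphim_homg ?subsetT.
by rewrite (eq_homgr _ isoGK) -sndK morphim_homg ?subsetT.
Qed.

(** The conditions force the orders 4 and p, which are coprime, so the subgroup generated by [s] and
    [t] already has 4p elements. *)
Lemma isoGrp_dicyclic_full (gT : finGroupType) (s t : gT) :
    #|gT| = (4 * p)%N -> 3 < p -> dicyclic_relations s t ->
    s ^+ 2 != 1 -> t != 1 ->
  [set: gT] \isog Grp (s : t : s ^+ 4 = t ^+ p = 1, s * t * s^-1 = t^-1).
Proof.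
move=> oG p_gt3 dic s2 t1; apply: isoGrp_dicyclic; first by rewrite cardsT.
exists s, t; split=> //; have [s4 tp _] := dic.
have ot : #[t] = p.
  apply/eqP; rewrite eqn_dvd order_dvdn tp eqxx /=.
  by rewrite -(nt_prime_order p_prime tp t1).
have os : #[s] = 4.
  have : #[s] %| 4 by rewrite order_dvdn s4.
  have : ~~ (#[s] %| 2) by rewrite order_dvdn.
  by case: #[s] => [|[|[|[|[|n]]]]] // _ /dvdn_leq.
apply/eqP; rewrite eqEcard subsetT cardsT oG dvdn_leq ?cardG_gt0 //.
rewrite Gauss_dvd ?coprime4_prime //.
by rewrite -{1}os -ot !cardSg ?joing_subl ?joing_subr.
Qed.

End DicyclicPresentation.

(** * Torsion subgroups of a finite abelian group *)

Section Torsion.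

Local Open Scope group_scope.

Implicit Types (V : finZmodType) (m n : nat).

(** Multiplicative notation for the additive group of [V]: [x ^+ m] is the m-fold sum of [x], and
    [1] is zero. *)
Definition torsion V m : {set V} := [set x : V | x ^+ m == 1].

Lemma group_set_torsion V m : group_set (torsion V m).
Proof.
apply/group_setP; split=> [|x y]; rewrite !inE ?expg1n // => /eqP xm /eqP ym.
by rewrite expgMn ?xm ?ym ?mulg1 //; apply: FinRing.zmod_mulgC.
Qed.

Canonical torsion_group V m := Group (group_set_torsion V m).

Lemma prime_dvd_torsion V m q : prime q -> q %| #|torsion V m| -> q %| m.
Proof.
move=> q_pr q_dv; have [x] := Cauchy q_pr q_dv.
by rewrite inE -order_dvdn => xm <-.
Qed.

Lemma coprime_card_torsion V m n :
  0 < n -> coprime m n -> coprime #|torsion V m| n.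
Proof.
move=> n_gt0 co_mn.
rewrite coprime_has_primes ?cardG_gt0 //; apply/hasPn=> q.
rewrite !mem_primes n_gt0 => /andP[q_pr q_n]; apply/negP=> /and3P[_ _ q_t].
have := prime_dvd_torsion q_pr q_t => q_m.
have : q %| gcdn m n by rewrite dvdn_gcd q_m q_n.
by rewrite (eqP co_mn) dvdn1 => /eqP q1; rewrite q1 in q_pr.
Qed.

Lemma mul_torsion V m n :
  #|V| = (m * n)%N -> coprime m n -> torsion V m * torsion V n = setT.
Proof.
move=> oV co_mn; apply/eqP; rewrite eqEsubset subsetT; apply/subsetP=> x _.
have xV : x ^+ (m * n) = 1 by rewrite -oV -cardsT expg_cardG ?inE.
have xE k : (m * n %| k)%N -> x ^+ k = 1.
  by case/dvdnP=> l ->; rewrite mulnC expgM xV expg1n.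
(* Modulo (m, n), [c] is (1, 0) and [d] is (0, 1), so c + d is 1 modulo mn, while [x ^+ c] is
   m-torsion and [x ^+ d] is n-torsion. *)
pose c := chinese m n 1 0; pose d := chinese m n 0 1.
have n_c : n %| c by rewrite /dvdn (chinese_modr co_mn) mod0n.
have m_d : m %| d by rewrite /dvdn (chinese_modl co_mn) mod0n.
have -> : x = x ^+ c * x ^+ d.
  rewrite -expgD -[LHS]expg1 -(expg_mod 1 xV) -(expg_mod (c + d) xV).
  congr (_ ^+ _); apply/eqP; rewrite chinese_remainder //.
  apply/andP; split; apply/eqP; rewrite -modnDm.
    by rewrite /c (chinese_modl co_mn) (eqP m_d) addn0 modn_mod.
  by rewrite /d (chinese_modr co_mn) (eqP n_c) add0n modn_mod.
apply: mem_mulg; rewrite inE -expgM xE //.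
  by rewrite mulnC dvdn_mul.
by rewrite dvdn_mul.
Qed.

(** The two torsion subgroups meet trivially and span [V], so their orders multiply to mn; since
    each is coprime to the other factor, divisibility leaves no choice. *)
Lemma card_torsion V m n :
  #|V| = (m * n)%N -> coprime m n -> #|torsion V m| = m.
Proof.
move=> oV co_mn.
have /andP[m_gt0 n_gt0] : (0 < m) && (0 < n).
  by rewrite -muln_gt0 -oV -cardsT cardG_gt0.
have co_m := coprime_card_torsion V n_gt0 co_mn.
have co_n : coprime m #|torsion V n|.
  by rewrite coprime_sym coprime_card_torsion // coprime_sym.
have oM : (#|torsion V m| * #|torsion V n|)%N = (m * n)%N.
  rewrite -oV -cardsT -(mul_torsion oV co_mn) TI_cardMg //.
  apply/trivgP/subsetP=> x; rewrite !inE -!order_dvdn => x_mn.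
  by rewrite -order_eq1 -dvdn1 -(eqP co_mn) dvdn_gcd.
apply/eqP; rewrite eqn_dvd -(Gauss_dvdl _ co_m) -oM dvdn_mulr //=.
by rewrite -(Gauss_dvdl _ co_n) oM dvdn_mulr.
Qed.

End Torsion.

(** * The lambda action of a left brace *)

(* Locked so that rewrite rules for sums do not match through the definition. *)
HB.lock Definition lam (B : leftBraceType) (a b : B) : B := ((a * b)%g - a)%R.

Section Brace.

Local Open Scope ring_scope.

Implicit Type B : leftBraceType.

Lemma lamE B (a b : B) : lam a b = (a * b)%g - a.
Proof. by rewrite lam.unlock. Qed.

Lemma brace_mulE B (a b : B) : (a * b)%g = a + lam a b.
Proof. by rewrite !lamE addrC subrK. Qed.

Lemma brace_one B : 1%g = 0 :> B.
Proof.
(* This instance of the axiom collapses to 0 = - [1%g]. *)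
have := braceDr (1%g : B) 0 0; rewrite !mul1g addr0 sub0r addr0.
by move/eqP; rewrite eq_sym oppr_eq0 => /eqP.
Qed.

Lemma lamD B (a b c : B) : lam a (b + c) = lam a b + lam a c.
Proof. by rewrite !lamE braceDr addrA. Qed.

Lemma lam0 B (a : B) : lam a 0 = 0.
Proof. by rewrite !lamE -{1}brace_one mulg1 subrr. Qed.

Lemma lamN B (a b : B) : lam a (- b) = - lam a b.
Proof. by apply/eqP; rewrite -addr_eq0 -lamD addNr lam0. Qed.

Lemma lamMn B (a b : B) n : lam a (b *+ n) = lam a b *+ n.
Proof. by elim: n => [|n IHn]; rewrite ?mulr0n ?lam0 // !mulrS lamD IHn. Qed.

Lemma lam1g B (a : B) : lam 1%g a = a.
Proof. by rewrite !lamE mul1g brace_one subr0. Qed.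

(** With [lamD], this makes [lam] an action of (B, o) by additive automorphisms. *)
Lemma lamM B (a b c : B) : lam (a * b)%g c = lam a (lam b c).
Proof.
rewrite [LHS]lamE [RHS]lamE -mulgA [(b * c)%g]brace_mulE braceDr -[_ - a + _]addrA.
by rewrite addrAC subrr add0r addrC.
Qed.

Lemma lamK B (a : B) : cancel (lam a) (lam a^-1%g).
Proof. by move=> b; rewrite -lamM mulVg lam1g. Qed.

Lemma lam_inj B (a : B) : injective (lam a).
Proof. exact: can_inj (lamK a). Qed.

End Brace.

Section FiniteBrace.

Local Open Scope ring_scope.

Variable B : finLeftBraceType.

(* (B, +) as a finite group: the finGroupType structure of B itself is (B, o). *)
Definition additive_group : finZmodType :=
  HB.pack (B : Type) (GRing.Zmodule.class B) (Finite.class B).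

(** Additive torsion, but as a set in the group (B, o): it is closed under o because [lam] preserves
    it, so Sylow theory in (B, o) applies to it. *)
Definition brace_torsion m : {set B} := [set x : B | x *+ m == 0].

Lemma group_set_brace_torsion m : group_set (brace_torsion m).
Proof.
apply/group_setP; split=> [|x y]; rewrite !inE ?brace_one ?mul0rn //.
by move=> /eqP xm /eqP ym; rewrite brace_mulE mulrnDl -lamMn xm ym lam0 addr0.
Qed.

Canonical brace_torsion_group m := Group (group_set_brace_torsion m).

Lemma card_brace_torsion m n :
  #|B| = (m * n)%N -> coprime m n -> #|brace_torsion m| = m.
Proof. exact: (@card_torsion additive_group). Qed.

Lemma brace_torsion_decomp m n (x : B) : #|B| = (m * n)%N -> coprime m n ->
  exists y z, [/\ y \in brace_torsion m, z \in brace_torsion n & x = y + z].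
Proof.
move=> oB co_mn; have := in_setT (x : additive_group).
rewrite -(@mul_torsion additive_group _ _ oB co_mn) => /mulsgP[y z ym zn ->].
by exists y, z.
Qed.

Lemma lam_torsion m (a x : B) : x \in brace_torsion m -> lam a x \in brace_torsion m.
Proof. by rewrite !inE -lamMn => /eqP->; rewrite lam0. Qed.

Lemma lamX_id n (a x : B) : lam a x = x -> lam (a ^+ n)%g x = x.
Proof. by move=> ax; elim: n => [|n IHn]; rewrite ?lam1g // expgS lamM IHn. Qed.

Lemma expg_lam_fixed n (a : B) : lam a a = a -> (a ^+ n)%g = a *+ n.
Proof.
move=> aa; elim: n => [|n IHn]; first by rewrite expg0 brace_one.
by rewrite expgS IHn brace_mulE lamMn aa mulrS.
Qed.

(** The inverse turns the left action [lam] into a right action, as the library requires. *)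
Definition lam_act (x a : B) := lam a^-1%g x.

Lemma lam_act1 : lam_act^~ 1%g =1 id.
Proof. by move=> x; rewrite /lam_act invg1 lam1g. Qed.

Lemma lam_actM x : act_morph lam_act x.
Proof. by move=> a b; rewrite /lam_act invMg lamM. Qed.

Definition lam_action := TotalAction lam_act1 lam_actM.

(* A nontrivial orbit under <[a]> would have #[a] elements, too many for the  *)
(* nonzero m-torsion. *)
Lemma lam_small_torsion m (a x : B) :
    prime #[a]%g -> (#|brace_torsion m| <= #[a]%g)%N -> x \in brace_torsion m ->
  lam a x = x.
Proof.
move=> a_pr le_m xm; have [->|x0] := eqVneq x 0; first exact: lam0.
have orbx b : b \in <[a]>%g -> lam b x \in orbit lam_action <[a]>%g x.
  by move=> ab; rewrite -[b]invgK; apply: mem_orbit; rewrite groupV.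
have : (#|orbit lam_action <[a]>%g x| %| #[a]%g)%N by exact: dvdn_orbit.
have [_ a_div] := primeP a_pr; move=> /a_div /orP[/eqP orb1 | /eqP orba].
  have /card_le1_eqP := eq_leq orb1; apply; last exact: orbx (cycle_id a).
  exact: orbit_refl.
suff : (#|orbit lam_action <[a]>%g x| < #|brace_torsion m|)%N.
  by rewrite orba ltnNge (leq_trans le_m).
apply: (@leq_ltn_trans #|brace_torsion m :\ 0|); last first.
  by rewrite [ltnRHS](cardsD1 0) inE mul0rn eqxx.
apply/subset_leq_card/subsetP=> _ /orbitP[b _ <-].
rewrite in_setD1 lam_torsion // andbT; apply: contraNneq x0 => bx.
by apply/eqP/(@lam_inj _ b^-1%g); rewrite lam0.
Qed.

End FiniteBrace.

Lemma brace_isomorphic_sym (A B : leftBraceType) :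
  brace_isomorphic A B -> brace_isomorphic B A.
Proof.
case=> f [[g fK gK] fD fM]; exists g; split; first by exists f.
  by move=> x y; apply: (can_inj fK); rewrite fD !gK.
by move=> x y; apply: (can_inj fK); rewrite fM !gK.
Qed.

(** * Braces built from an additive involution and a parity *)

Section TwistedBrace.

Local Open Scope ring_scope.

(* The data (f, e) defining the brace x o y = x + f^(e x) y on a finite zmodType. *)
Record twist_datum := TwistDatum {
  twist_zmod :> finZmodType;
  twist_fun : twist_zmod -> twist_zmod;
  twist_par : twist_zmod -> bool;
  twist_funD : {morph twist_fun : x y / x + y};
  twist_funK : involutive twist_fun;
  twist_parD : {morph twist_par : x y / x + y >-> x (+) y};
  twist_par_fun : forall x, twist_par (twist_fun x) = twist_par x }.

Variable D : twist_datum.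

(** An alias of the carrier that keeps its addition but receives o as its group law. *)
Definition twist : Type := twist_zmod D.

HB.instance Definition _ := FinRing.Zmodule.copy twist (twist_zmod D).

Implicit Types x y z : twist.

Definition twist_act (b : bool) (x : twist) : twist := if b then twist_fun x else x.
Definition twist_mul (x y : twist) : twist := x + twist_act (twist_par x) y.
Definition twist_inv (x : twist) : twist := - twist_act (twist_par x) x.

Lemma twist_actD b : {morph twist_act b : x y / x + y}.
Proof. by case: b => // x y; apply: twist_funD. Qed.

Lemma twist_act_par b x : twist_par (twist_act b x) = twist_par x.
Proof. by case: b => //=; rewrite twist_par_fun. Qed.

Lemma twist_act_add b c x : twist_act b (twist_act c x) = twist_act (b (+) c) x.
Proof. by case: b c => [] [] //=; rewrite twist_funK. Qed.

Lemma twist_par0 : twist_par (0 : twist) = false.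
Proof. by apply/negP=> par0; have := twist_parD (0 : D) 0; rewrite addr0 par0. Qed.

Lemma twist_parN x : twist_par (- x) = twist_par x.
Proof.
have := twist_parD (- x : D) x; rewrite addNr twist_par0.
by case: (twist_par x); case: (twist_par _).
Qed.

(** Invariance of the parity under f makes it a homomorphism for o as well; associativity of o
    follows. *)
Lemma twist_par_mul x y : twist_par (twist_mul x y) = twist_par x (+) twist_par y.
Proof. by rewrite [LHS]twist_parD twist_act_par. Qed.

Lemma twist_mulA : associative twist_mul.
Proof.
move=> x y z; rewrite {1 3}/twist_mul twist_par_mul -twist_act_add -addrA.
by rewrite -twist_actD.
Qed.

Lemma twist_mul0 : left_id 0 twist_mul.
Proof. by move=> x; rewrite /twist_mul twist_par0 add0r. Qed.

Lemma twist_mulV : left_inverse 0 twist_inv twist_mul.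
Proof.
by move=> x; rewrite /twist_mul [twist_par _]twist_parN twist_act_par addNr.
Qed.

HB.instance Definition _ :=
  Finite_isGroup.Build twist twist_mulA twist_mul0 twist_mulV.

Lemma twist_mulE x y : (x * y)%g = x + twist_act (twist_par x) y.
Proof. by []. Qed.

Lemma twist_braceDr x y z : (x * (y + z)%R)%g = (x * y)%g - x + (x * z)%g.
Proof. by rewrite !twist_mulE twist_actD !addrA subrK. Qed.

HB.instance Definition _ := ZmodGroup_isLeftBrace.Build twist twist_braceDr.

Definition twisted_brace : finLeftBraceType := twist.

End TwistedBrace.

(** An additive surjection between sets of equal size is bijective; if it also intertwines the
    lambda maps, it respects o, by [brace_mulE]. *)
Lemma twist_brace_isomorphic (D : twist_datum) (B : finLeftBraceType)
    (phi : D -> B) :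
    #|B| = #|D| ->
    (forall x, exists v, phi v = x) ->
    {morph phi : x y / (x + y)%R} ->
    (forall x y, lam (phi x) (phi y) = phi (twist_act (twist_par x) y)) ->
  brace_isomorphic B (twisted_brace D).
Proof.
move=> oB phi_surj phiD phi_lam.
have phi_inj : injective phi.
  suff /imset_injP phi_inj : #|[set phi x | x in [set: D]]| == #|[set: D]|.
    by move=> x y; apply: phi_inj; rewrite inE.
  rewrite cardsT -oB -cardsT; apply/eqP; congr #|pred_of_set _|.
  apply/eqP; rewrite eqEsubset subsetT; apply/subsetP=> x _.
  by have [v <-] := phi_surj x; apply: imset_f; rewrite inE.
have [psi phiK psiK] : bijective phi by apply: inj_card_bij; rewrite ?oB.
exists (psi : B -> twisted_brace D); split; first by exists phi.
  by move=> x y; apply: phi_inj; rewrite phiD !psiK.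
move=> x y; apply: phi_inj; rewrite psiK [RHS]phiD -phi_lam !psiK.
exact: brace_mulE.
Qed.

(** The hypotheses are the relations in additive form: s o s = s + f s has even parity, so the
    fourth power of s is 2(s + f s); powers of t are multiples; and s o t = s - t is the product of
    the o-inverse of t with s. *)
Lemma twist_quaternion (D : twist_datum) (p : nat) (s t : D) :
    prime p -> (3 < p)%N -> #|D| = (4 * p)%N ->
    twist_par s -> ~~ twist_par t ->
    ((s + twist_fun s) *+ 2 = 0)%R -> (t *+ p = 0)%R ->
    (twist_fun t = - t)%R -> (s + twist_fun s != 0)%R -> t != 0%R ->
  quaternion_brace p (twisted_brace D).
Proof.
move=> p_pr p_gt3 oD par_s /negbTE par_t s4 tp ft s2 t1.
have expE (x : twisted_brace D) n :
    twist_par (x : D) = false -> (x ^+ n)%g = (x *+ n)%R.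
  move=> par_x; elim: n => // n IHn; rewrite expgS IHn mulrS.
  by rewrite [LHS]twist_mulE par_x.
pose s' : twisted_brace D := s; pose t' : twisted_brace D := t.
have s2E : (s' ^+ 2)%g = (s + twist_fun s)%R.
  by rewrite expgS expg1 [LHS]twist_mulE par_s.
have par_s2 : twist_par (s + twist_fun s)%R = false.
  by rewrite twist_parD twist_par_fun par_s.
apply: (@isoGrp_dicyclic_full p p_pr (twisted_brace D) s' t') => //.
- split; last first.
  + have -> : (t'^-1)%g = (- t)%R.
      apply: (mulIg t'); rewrite mulVg [RHS]twist_mulE [twist_par _]twist_parN.
      by rewrite par_t addNr.
    apply: (mulIg s'); rewrite mulgKV [LHS]twist_mulE [RHS]twist_mulE par_s.
    by rewrite [twist_par _]twist_parN par_t /= ft addrC.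
  + by rewrite expE.
  + by rewrite (expgM s' 2 2) s2E expE.
- by rewrite s2E.
Qed.

(** Lets a product of two [finZmodType]s be one, as the carriers of the models must be. *)
HB.instance Definition _ (U V : finZmodType) := GRing.Zmodule.on (U * V)%type.

(** * The two models, on Z/4 x Z/p and on (Z/2)^2 x Z/p *)

Section Models.

Local Open Scope ring_scope.

(** Reduction modulo m does not affect multiples of an m-torsion element. This yields the additivity
    of the maps [phi] out of the models. *)
Lemma mulrn_ZpD (V : zmodType) (x : V) m (i j : 'Z_m) :
  (1 < m)%N -> x *+ m = 0 -> x *+ (i + j)%R = x *+ i + x *+ j.
Proof.
move=> m_gt1; rewrite -[m in x *+ m](Zp_cast m_gt1) => xm.
rewrite -mulrnDr [in RHS](divn_eq (i + j) (Zp_trunc m).+2) mulrnDr.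
by rewrite mulnC mulrnA xm mul0rn add0r.
Qed.

Lemma mulrn_ZpN (V : zmodType) (x : V) m (i : 'Z_m) :
  (1 < m)%N -> x *+ m = 0 -> x *+ (- i)%R = - (x *+ i).
Proof.
move=> m_gt1 xm; apply/eqP; rewrite -addr_eq0 -mulrn_ZpD // addNr.
by rewrite mulr0n.
Qed.

Lemma Zp_mulrn0 m (i : 'Z_m) : (1 < m)%N -> i *+ m = 0.
Proof. by move=> m_gt1; rewrite -mulr_natr pchar_Zp ?mulr0. Qed.

Lemma odd_ZpD m (i j : 'Z_m.+2) : ~~ odd m -> odd (i + j)%R = odd i (+) odd j.
Proof. by move=> m_even; rewrite /= odd_mod ?oddD //= (negbTE m_even). Qed.

Lemma pair_mulrn (U V : zmodType) (x : U * V) n : x *+ n = (x.1 *+ n, x.2 *+ n).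
Proof. by case: x => x y; elim: n => // n IHn; rewrite !mulrS IHn. Qed.

Variable p : nat.
Hypothesis p_gt1 : (1 < p)%N.

Definition cyclic_fun (v : 'Z_4 * 'Z_p) : 'Z_4 * 'Z_p := (v.1, - v.2).
Definition cyclic_par (v : 'Z_4 * 'Z_p) := odd v.1.

Definition cyclic_datum : twist_datum.
Proof.
refine (@TwistDatum ('Z_4 * 'Z_p)%type cyclic_fun cyclic_par _ _ _ _) => //.
- by move=> x y; rewrite /cyclic_fun /= opprD.
- by case=> x y; rewrite /cyclic_fun opprK.
- by move=> x y; rewrite -odd_ZpD.
Defined.

(** A transvection on (Z/2)^2 times negation on Z/p. In the classification the coordinates are those
    along [s], [s ^+ 2] and [t]. *)
Definition elementary_fun (v : 'Z_2 * 'Z_2 * 'Z_p) : 'Z_2 * 'Z_2 * 'Z_p :=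
  (v.1.1, v.1.2 + v.1.1, - v.2).
Definition elementary_par (v : 'Z_2 * 'Z_2 * 'Z_p) := odd v.1.1.

Definition elementary_datum : twist_datum.
Proof.
refine (@TwistDatum ('Z_2 * 'Z_2 * 'Z_p)%type
  elementary_fun elementary_par _ _ _ _) => //.
- by move=> x y; rewrite /elementary_fun /= opprD addrACA.
- case=> [[x1 x2] y]; rewrite /elementary_fun /= opprK -addrA -mulr2n -mulr_natr.
  by rewrite pchar_Zp // mulr0 addr0.
- by move=> x y; rewrite -odd_ZpD.
Defined.

Definition cyclic_brace := twisted_brace cyclic_datum.
Definition elementary_brace := twisted_brace elementary_datum.

Lemma card_cyclic_brace : #|cyclic_brace| = (4 * p)%N.
Proof.
rewrite -[LHS]/#|{: 'Z_4 * 'Z_p}| card_prod (card_ord (Zp_trunc p).+2).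
by rewrite (Zp_cast p_gt1) card_ord.
Qed.

Lemma card_elementary_brace : #|elementary_brace| = (4 * p)%N.
Proof.
rewrite -[LHS]/#|{: 'Z_2 * 'Z_2 * 'Z_p}| !card_prod (card_ord (Zp_trunc p).+2).
by rewrite (Zp_cast p_gt1) !card_ord.
Qed.

(** As p is odd, 2p is 2 modulo 4, so 2p times (1, 0) is nonzero in the cyclic model, whereas 2p
    kills the elementary one. *)
Lemma cyclic_not_elementary :
  odd p -> ~ brace_isomorphic cyclic_brace elementary_brace.
Proof.
move=> p_odd [f [/bij_inj f_inj fD _]].
have f0 : f 0 = 0 by apply: (addIr (f 0)); rewrite -fD !add0r.
have fMn x n : f (x *+ n) = f x *+ n.
  by elim: n => [|n IHn]; rewrite ?mulr0n // !mulrS fD IHn.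
pose x : 'Z_4 * 'Z_p := (1, 0).
have elem2p (v : 'Z_2 * 'Z_2 * 'Z_p) : v *+ (2 * p) = 0.
  by rewrite !pair_mulrn /= !mulrnA [v.2 *+ _ *+ _]mulrnAC !Zp_mulrn0 ?mul0rn.
have : f (x *+ (2 * p)) = f 0 by rewrite fMn f0; apply: elem2p.
move/f_inj => /(congr1 (fun v : 'Z_4 * 'Z_p => val v.1)).
rewrite [x *+ _]pair_mulrn /= -[LHS]/(((2 * p)%:R : 'Z_4) : nat) val_Zp_nat //.
by rewrite -(odd_double_half p) p_odd -muln2 mulnDr mulnCA addnC modnMDl.
Qed.

Lemma cyclic_quaternion : prime p -> (3 < p)%N -> quaternion_brace p cyclic_brace.
Proof.
move=> p_pr p_gt3.
apply: (@twist_quaternion cyclic_datum p (1, 0) (0, 1)) => //.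
- exact: card_cyclic_brace.
- by rewrite [LHS]pair_mulrn /= oppr0 addr0 mul0rn; congr pair; apply: val_inj.
- by rewrite [LHS]pair_mulrn /= mul0rn pchar_Zp.
- by rewrite -[RHS]/(- 0, - 1) oppr0.
Qed.

Lemma elementary_quaternion :
  prime p -> (3 < p)%N -> quaternion_brace p elementary_brace.
Proof.
move=> p_pr p_gt3.
(* Here s + f s = (0, 1, 0): s has additive order 2 but multiplicative order 4. *)
apply: (@twist_quaternion elementary_datum p (1, 0, 0) (0, 0, 1)) => //.
- exact: card_elementary_brace.
- rewrite [LHS]pair_mulrn /= oppr0 addr0 mul0rn pair_mulrn /=.
  by congr pair; congr pair; apply: val_inj.
- by rewrite [LHS]pair_mulrn /= pair_mulrn !mul0rn pchar_Zp.
- by rewrite -[RHS]/(- 0, - 0, - 1) !oppr0 /= /elementary_fun /= addr0.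
Qed.

End Models.

(** * Generators adapted to the additive torsion *)

Section QuaternionBrace.

Local Open Scope group_scope.

Lemma Sylow_card_conj (gT : finGroupType) (G H K : {group gT}) q k n :
    prime q -> #|G| = (q ^ k * n)%N -> coprime q n ->
    H \subset G -> K \subset G -> #|H| = (q ^ k)%N -> #|K| = (q ^ k)%N ->
  exists2 x, x \in G & K = H :^ x :> {set gT}.
Proof.
move=> q_pr oG co_qn sHG sKG oH oK.
have oGq : (#|G|`_q = q ^ k)%N.
  have n_gt0 : (0 < n)%N.
    by case: n oG {co_qn} => // /eqP; rewrite muln0 (gtn_eqF (cardG_gt0 G)).
  have qk_gt0 : (0 < q ^ k)%N by rewrite expn_gt0 prime_gt0.
  rewrite oG partnM // part_pnat_id; last by rewrite pnatX pnat_id.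
  by rewrite part_p'nat ?muln1 // p'natE // -prime_coprime.
have sylH : q.-Sylow(G) H by rewrite pHallE sHG oH oGq eqxx.
have sylK : q.-Sylow(G) K by rewrite pHallE sKG oK oGq eqxx.
by have [x Gx ->] := Sylow_trans sylH sylK; exists x.
Qed.

Variables (p : nat) (B : finLeftBraceType).
Hypotheses (p_pr : prime p) (p_gt3 : (3 < p)%N) (oB : #|B| = (4 * p)%N).

(** Since 4p is at most the product of the orders of the generators, these orders are 4 and p. By
    Sylow, the 4-torsion is a conjugate of [<[s]>] by some x, and the p-torsion is the normal
    subgroup [<[t]>]; conjugating both generators by x keeps the relations. *)
Lemma quaternion_brace_generators : quaternion_brace p B ->
  exists s t : B, [/\ dicyclic_relations p s t,
    brace_torsion B 4 = <[s]> & brace_torsion B p = <[t]>].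
Proof.
move/isoGrp_hom/(@homg_dicyclicP p B [set: B]%G) => [s [t [defB dic]]].
have [s4 tp st] := dic.
have [le_s le_t] : #[s] <= 4 /\ #[t] <= p.
  by split; apply: dvdn_leq; rewrite ?(prime_gt0 p_pr) // order_dvdn ?s4 ?tp.
have le_B : 4 * p <= #[s] * #[t].
  rewrite -oB -cardsT -defB joingC (dicyclic_gen_mul dic) mulnC mul_cardG.
  by rewrite leq_pmulr // cardG_gt0.
have os : #[s] = 4.
  apply/eqP; rewrite eqn_leq le_s -(@leq_pmul2r p) ?prime_gt0 //.
  by rewrite (leq_trans le_B) // leq_mul2l le_t orbT.
have ot : #[t] = p.
  apply/eqP; rewrite eqn_leq le_t -(@leq_pmul2l 4) //.
  by rewrite (leq_trans le_B) // leq_mul2r le_s orbT.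
have co4p : coprime 4 p by exact: coprime4_prime.
have o4 := card_brace_torsion oB co4p.
have op : #|brace_torsion B p| = p.
  by apply: (@card_brace_torsion B p 4); rewrite ?oB 1?mulnC // coprime_sym.
have co2p : coprime 2 p by rewrite -(@coprime_pexpl 2 2).
have [x _ def4] :
    exists2 x, x \in [set: B]%G & brace_torsion B 4 = <[s]> :^ x :> {set B}.
  apply: (@Sylow_card_conj B [set: B]%G <[s]>%G (brace_torsion_group B 4)
    2 2 p); by rewrite ?cardsT ?subsetT.
have [y _ defp] :
    exists2 y, y \in [set: B]%G & brace_torsion B p = <[t]> :^ y :> {set B}.
  apply: (@Sylow_card_conj B [set: B]%G <[t]>%G (brace_torsion_group B p)
    p 1 4); by rewrite ?cardsT ?subsetT ?expn1 ?oB 1?mulnC // coprime_sym.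
have nt z : <[t]> :^ z = <[t]>.
  have : z \in [set: B] by rewrite inE.
  rewrite -defB => Bz; apply/normP; apply: subsetP Bz.
  by rewrite join_subG (dicyclic_norm dic) normG.
exists (s ^ x), (t ^ x); split; last 2 first.
- by rewrite def4 cycleJ.
- by rewrite defp cycleJ !nt.
by split; rewrite -?conjXg ?s4 ?tp ?conj1g // -!conjVg -!conjMg st.
Qed.

End QuaternionBrace.

(** * Determination of the lambda action *)

Section Classification.

Local Open Scope ring_scope.

Variables (p : nat) (B : finLeftBraceType) (s t : B).
Hypotheses (p_pr : prime p) (p_gt3 : (3 < p)%N) (oB : #|B| = (4 * p)%N).
Hypotheses (dic : dicyclic_relations p s t).
Hypotheses (def4 : brace_torsion B 4 = <[s]>%g) (defp : brace_torsion B p = <[t]>%g).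

Let p_gt1 : (1 < p)%N := prime_gt1 p_pr.

Let co4p : coprime 4 p := coprime4_prime p_pr p_gt3.

Let order_s : #[s]%g = 4.
Proof. by rewrite orderE -def4 (card_brace_torsion oB co4p). Qed.

Let order_t : #[t]%g = p.
Proof.
by rewrite orderE -defp (@card_brace_torsion B p 4) 1?mulnC // coprime_sym.
Qed.

Let s_mul4 : s *+ 4 = 0.
Proof. by apply/eqP; have := cycle_id s; rewrite -def4 inE. Qed.

Let t_mulp : t *+ p = 0.
Proof. by apply/eqP; have := cycle_id t; rewrite -defp inE. Qed.

Lemma brace_decomp (x : B) :
  exists i j, [/\ (i < 4)%N, (j < p)%N & x = (s ^+ i)%g + (t ^+ j)%g].
Proof.
have [y [z []]] := brace_torsion_decomp x oB co4p.
rewrite def4 defp => /cyclePmin[i]; rewrite order_s => lt_i ->.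
by move=> /cyclePmin[j]; rewrite order_t => lt_j -> ->; exists i, j.
Qed.

Lemma lam_t (x : B) : lam t x = x.
Proof.
have [i [j [_ _ ->]]] := brace_decomp x; rewrite lamD; congr (_ + _).
  (* Here p > 3 is needed: the 4-torsion must have at most p elements. *)
  apply: (@lam_small_torsion _ 4); rewrite ?order_t ?def4 ?mem_cycle //.
  by rewrite -orderE order_s.
apply: (@lam_small_torsion _ p); rewrite ?order_t ?defp ?mem_cycle //.
by rewrite -orderE order_t.
Qed.

Lemma expg_t n : (t ^+ n)%g = t *+ n.
Proof. exact/expg_lam_fixed/lam_t. Qed.

(** Since [lam y] negates or otherwise moves only within the kernel of nothing but [lam t] fixes
    [y], one has y + jt = t^j o y, and [t ^+ j] acts trivially. So [lam] depends only on the
    4-torsion component. *)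
Lemma lam_add_t (y x : B) j : lam (y + t *+ j) x = lam y x.
Proof.
have -> : y + t *+ j = ((t ^+ j) * y)%g.
  by rewrite brace_mulE (lamX_id _ (lam_t y)) expg_t addrC.
by rewrite lamM (lamX_id _ (lam_t _)).
Qed.

(** Compare s o t = s + [lam s t] with its other form under the relation, the o-inverse of t times
    s, which is - t + s because [lam t] is trivial. *)
Lemma lam_s_t : lam s t = - t.
Proof.
have [_ _ st] := dic.
have tV : (t^-1)%g = - t.
  by apply: (mulgI t); rewrite mulgV brace_one brace_mulE lam_t subrr.
apply: (addrI s); rewrite -brace_mulE addrC -tV.
rewrite -[(s * t)%g](mulgKV s) st brace_mulE tV; congr (_ + _).
by apply: (@lam_inj _ t); rewrite -lamM -tV mulgV lam1g lam_t.
Qed.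

Lemma lam_expg_s n (x : B) :
  (forall y, lam s (lam s y) = y) -> lam (s ^+ n)%g x = if odd n then lam s x else x.
Proof.
move=> lam_ss; elim: n => [|n IHn]; first by rewrite expg0 lam1g.
by rewrite expgS lamM IHn /=; case: (odd n) => //=.
Qed.

(** [lam s] permutes the three nonzero elements s, s^2, s^3 of the 4-torsion, and s^(n+1) = s +
    [lam s] (s^n). These recursions exclude all but two permutations. *)
Lemma lam_sylow2_cases :
  lam s s = s \/
  [/\ s *+ 2 = 0, lam s s = s + (s ^+ 2)%g & lam s (s ^+ 2)%g = (s ^+ 2)%g].
Proof.
have sX_inj i j : (i < 4)%N -> (j < 4)%N -> (s ^+ i = s ^+ j)%g -> i = j.
  move=> lt_i lt_j /eqP; rewrite eq_expg_mod_order order_s !modn_small //.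
  by move/eqP.
have lam_s_cases n : (0 < n < 4)%N ->
    [\/ lam s (s ^+ n)%g = s, lam s (s ^+ n)%g = (s ^+ 2)%g
      | lam s (s ^+ n)%g = (s ^+ 3)%g].
  move=> /andP[n_gt0 n_lt4].
  have : lam s (s ^+ n)%g \in brace_torsion B 4.
    by rewrite lam_torsion // def4 mem_cycle.
  rewrite def4 => /cyclePmin[i]; rewrite order_s.
  case: i => [|[|[|[|i]]]] // _ sni;
    [|by constructor 1|by constructor 2|by constructor 3].
  have /lam_inj/(sX_inj n 0) : lam s (s ^+ n)%g = lam s (s ^+ 0)%g.
    by rewrite sni expg0 brace_one lam0.
  by move=> n0; rewrite n0 in n_gt0.
have s_neq0 : s != 0.
  apply/eqP => s0; have := sX_inj 1 0 isT isT.
  by rewrite expg1 expg0 brace_one => /(_ s0).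
have mulS n : (s ^+ n.+1)%g = s + lam s (s ^+ n)%g by rewrite expgS brace_mulE.
have [| fs | fs] := lam_s_cases 1 isT; rewrite ?expg1; first by left.
  (* If [lam s s] is s^2, then s^2 = s + s^2 and s = 0. *)
  move: s_neq0; have /eqP := mulS 1.
  by rewrite fs -{1}[(s ^+ 2)%g]add0r (inj_eq (addIr _)) eq_sym => ->.
rewrite expg1 in fs.
have s2 : (s ^+ 2)%g = s + (s ^+ 3)%g by rewrite (mulS 1) expg1 fs.
have s3 := mulS 2.
have [fs2 | fs2 | fs2] := lam_s_cases 2 isT.
(* Here s^3 = 2s, which [lam s] sends to 2 s^3 = 4s = 0, so s^3 = 0. *)
- rewrite fs2 -mulr2n in s3.
  have : lam s (s *+ 2) = lam s 0 by rewrite lamMn fs s3 -mulrnA s_mul4 lam0.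
  by move/lam_inj; rewrite -s3 -brace_one => /(sX_inj 3 0 isT isT).
(* Substituting s^3 = s + s^2 into s^2 = s + s^3 gives 2s = 0. *)
- right; rewrite fs2 in s3; split=> //; last by rewrite fs.
  by apply: (addIr (s ^+ 2)%g); rewrite mulr2n -addrA -s3 -s2 add0r.
- by have := etrans fs2 (esym fs) => /lam_inj /(sX_inj 2 1 isT isT).
Qed.

(** As [s] is fixed by its own lambda map, its powers are its multiples, so [s] and [t] serve as
    additive coordinates; [lam s] is an involution, whence only the parity of the exponent of [s]
    matters. *)
Lemma cyclic_brace_isomorphic : lam s s = s -> brace_isomorphic B (cyclic_brace p).
Proof.
move=> ss; pose phi (v : 'Z_4 * 'Z_p) : B := s *+ v.1 + t *+ v.2.
have sX n : (s ^+ n)%g = s *+ n by exact: expg_lam_fixed.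
have lam_ss x : lam s (lam s x) = x.
  have [i [j [_ _ ->]]] := brace_decomp x.
  by rewrite sX expg_t !(lamD, lamMn, ss, lam_s_t, lamN) opprK.
apply: (@twist_brace_isomorphic (cyclic_datum p) B phi).
- by rewrite oB; apply/esym/(card_cyclic_brace p_gt1).
- move=> x; have [i [j [lt_i lt_j ->]]] := brace_decomp x.
  exists (i%:R, j%:R); rewrite /phi /= !val_Zp_nat // !modn_small //.
  by rewrite sX expg_t.
- move=> x y; rewrite /phi /= !mulrn_ZpD //; exact: addrACA.
move=> x y; rewrite {1}/phi lam_add_t -sX lam_expg_s //= /cyclic_par.
case: (odd x.1) => //=; rewrite /phi /= mulrn_ZpN //.
by rewrite lamD !lamMn ss lam_s_t mulNrn.
Qed.

Lemma elementary_brace_isomorphic :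
    s *+ 2 = 0 -> lam s s = s + (s ^+ 2)%g -> lam s (s ^+ 2)%g = (s ^+ 2)%g ->
  brace_isomorphic B (elementary_brace p).
Proof.
set r := (s ^+ 2)%g => s2 lam_s_s lam_s_r.
have r2 : r *+ 2 = 0.
  have : lam s (s *+ 2) = 0 by rewrite s2 lam0.
  by rewrite lamMn lam_s_s mulrnDl s2 add0r.
have s3 : (s ^+ 3)%g = s + r by rewrite expgS brace_mulE lam_s_r.
pose phi (v : 'Z_2 * 'Z_2 * 'Z_p) : B := s *+ v.1.1 + r *+ v.1.2 + t *+ v.2.
have phi_surj x : exists v, phi v = x.
  have [i [j [lt_i lt_j ->]]] := brace_decomp x.
  (* The powers s^0, s^1, s^2, s^3 are 0, s, r, s + r: the binary digits of i are the coordinates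
     along s and r. *)
  exists ((odd i)%:R, (1 < i)%N%:R, j%:R).
  rewrite /phi /= !val_Zp_nat // (modn_small lt_j) expg_t; congr (_ + _).
  case: i lt_i => [|[|[|[|i]]]] // _; rewrite /= ?mulr0n ?mulr1n ?add0r ?addr0 //.
  by rewrite expg0 brace_one.
have lam_ss x : lam s (lam s x) = x.
  have [v <-] := phi_surj x; rewrite /phi.
  rewrite !(lamD, lamMn, lam_s_s, lam_s_r, lam_s_t, lamN) opprK.
  by rewrite -[s + r + r]addrA -mulr2n r2 addr0.
apply: (@twist_brace_isomorphic (elementary_datum p) B phi) => //.
- by rewrite oB; apply/esym/(card_elementary_brace p_gt1).
- move=> x y; rewrite /phi /= !mulrn_ZpD //.
  by rewrite [s *+ _ + _ + (r *+ _ + _)]addrACA [LHS]addrACA.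
move=> x y; rewrite {1}/phi lam_add_t /=.
(* The same digits read backwards; the parity of the exponent is the coordinate along s. *)
have -> : s *+ x.1.1 + r *+ x.1.2 = (s ^+ (x.1.1 + x.1.2 * 2))%g.
  case: (x.1) => [[[|[|u]] // lt_u] [[|[|v]] // lt_v]] /=.
  - by rewrite expg0 brace_one addr0.
  - by rewrite mulr0n mulr1n add0r.
  - by rewrite mulr0n mulr1n addr0.
rewrite lam_expg_s // oddD oddM andbF addbF /elementary_par.
case: (odd x.1.1) => //=; rewrite /phi /= mulrn_ZpN // mulrn_ZpD //.
rewrite !(lamD, lamMn, lam_s_s, lam_s_r, lam_s_t, lamN) mulNrn mulrnDl.
by rewrite -[s *+ _ + r *+ _ + _]addrA; congr (_ + _ + _); apply: addrC.
Qed.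

End Classification.

Theorem mainTheorem2 (p : nat) (p_prime : prime p) (p_gt3 : 3 < p) :
  num_iso_classes (fun B => #|B| = 4 * p /\ quaternion_brace p B) 2.
Proof.
have p_gt1 := prime_gt1 p_prime.
have p_odd : odd p by case: (even_prime p_prime) p_gt3 => [->|].
have neq := cyclic_not_elementary p_gt1 p_odd.
pose r (i : 'I_2) := if i == ord0 then cyclic_brace p else elementary_brace p.
exists r; split.
- move=> i; rewrite /r; case: eqP => _; split.
  + exact: card_cyclic_brace.
  + exact: cyclic_quaternion.
  + exact: card_elementary_brace.
  + exact: elementary_quaternion.
- move=> [[|[|//]] lt_i] [[|[|//]] lt_j] iso_ij; apply: val_inj => //=.
  by case: neq; exact: brace_isomorphic_sym iso_ij.
move=> B [oB qB].
have [s [t [dic def4 defp]]] := quaternion_brace_generators p_prime p_gt3 oB qB.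
have [ss | [s2 ss sr]] := lam_sylow2_cases p_prime p_gt3 oB def4.
  by exists ord0; apply: (cyclic_brace_isomorphic p_prime p_gt3 oB dic def4 defp).
exists ord_max; exact: (elementary_brace_isomorphic p_prime p_gt3 oB dic def4 defp).
Qed.
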